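(* For every program $P$, every scheduler $\Sigma : \mathbb{N} \to \{\mathit{execute}, \mathit{delay}\}$ valid for $P$, all memories $m_1, m_2 : \mathbb{N} \to \mathbb{Z}$, all register assignments $a_1, a_2 : \{r_1, r_2\} \to \mathbb{Z}$, every cache $c$ and every program counter $\mathit{pc} \in \mathbb{N}$, the sequential contract system $\mathcal{C}_P$ and the out-of-order hardware system $\mathcal{H}_P$ satisfy $$[\![ (m_1, a_1, \mathit{pc}) ]\!]_{\mathcal{C}_P} = [\![ (m_2, a_2, \mathit{pc}) ]\!]_{\mathcal{C}_P} \implies [\![ ((m_1, a_1, \mathit{pc}, c), \bot) ]\!]_{\mathcal{H}_P} = [\![ ((m_2, a_2, \mathit{pc}, c), \bot) ]\!]_{\mathcal{H}_P}.$$
   Context: A (deterministic) transition system consists of states, observations, and functions $\mathit{next}$ and $\mathit{leak}$ on states; writing $q \xrightarrow{o} q'$ means $q' = \mathit{next}(q)$ and $o = \mathit{leak}(q)$. The infinite trace $[\![ q ]\!]$ is the sequence $\mathit{leak}(q)\ \mathit{leak}(\mathit{next}(q))\ \mathit{leak}(\mathit{next}^2(q))\ldots$ ISA. Registers are $r_1, r_2$. Instructions are $\mathbf{load}\ x_1, x_2$; $\mathbf{add}\ x_1, x_2, k$; and $\mathbf{beqz}\ x, l$, with $x, x_1, x_2 \in \{r_1,r_2\}$, $k \in \mathbb{Z}$, $l \in \mathbb{N}$. A program $P$ assigns to each location $n \in \mathbb{N}$ an instruction $P(n)$. An architectural state is $\sigma = (m, a, \mathit{pc})$ with memory $m : \mathbb{N}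 \to \mathbb{Z}$, registers $a : \{r_1,r_2\} \to \mathbb{Z}$ and $\mathit{pc} \in \mathbb{N}$; its components are written $\sigma.a$, $\sigma.\mathit{pc}$, etc., and $[\mathit{pc} \mapsto n]$ denotes replacing the program counter by $n$. For $v \in \mathbb{Z}$ let $\overline{v} = \max(v,0)$ (negative values used as addresses are truncated to $0$). Single-instruction architectural semantics $(\sigma, i) \Rightarrow_{\mathit{isa}} \sigma'$, for $\sigma = (m,a,\mathit{pc})$: - $i = \mathbf{add}\ x_1,x_2,k$: $\sigma' = (m, a[x_1 \mapsto a(x_2)+k], \mathit{pc}+1)$; - $i = \mathbf{load}\ x_1,x_2$: $\sigma' = (m, a[x_1 \mapsto m(\overline{a(x_2)})], \mathit{pc}+1)$; - $i = \mathbf{beqz}\ x,l$: $\sigma' = (m,a,l)$ if $a(x)=0$, and $\sigma' = (m,a,\mathit{pc}+1)$ otherwise. A vanilla hardware state is $s = (\sigma, c)$, also written $(m,a,\mathit{pc},c)$, where the cache $c$ is a finite list of addresses. Single-instruction hardware semantics $(s,i) \Rightarrow_{\mathcal H}^{c} s'$ (observation label $c$, the current cache): if $(\sigma,i) \Rightarrow_{\mathit{isa}} \sigma'$, then $s' = (\sigma', \overline{a(x_2)} :: c)$ when $i = \mathbf{load}\ x_1,x_2$, and $s' = (\sigma', c)$ otherwise. Sequential contract $\mathcal{C}_P$. States are architectural states; observations are integers, Booleans, or $\bot$ (all distinct). If $(\sigma, P(\sigma.\mathit{pc})) \Rightarrow_{\mathit{isa}} \sigma'$ then $\sigma \xrightarrow{o}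 \sigma'$, where $o = \sigma.a(x_2)$ if $P(\sigma.\mathit{pc}) = \mathbf{load}\ x_1,x_2$; $o$ is the Boolean truth value of $\sigma.a(x)=0$ if $P(\sigma.\mathit{pc}) = \mathbf{beqz}\ x,l$; and $o = \bot$ otherwise. Delayability. Define $\mathit{src}(\mathbf{add}\ x_1,x_2,k) = x_2$, $\mathit{src}(\mathbf{load}\ x_1,x_2) = x_2$, $\mathit{src}(\mathbf{beqz}\ x,l) = x$, and $\mathit{des}(\mathbf{add}\ x_1,x_2,k) = x_1$, $\mathit{des}(\mathbf{load}\ x_1,x_2) = x_1$, $\mathit{des}(\mathbf{beqz}\ x,l) = \mathsf{pc}$, where $\mathsf{pc}$ is a symbol for the program-counter component, distinct from $r_1,r_2$. Then $\mathit{delayable}(i_1,i_2)$ holds iff $i_1$ is not a $\mathbf{beqz}$ instruction, $\mathit{des}(i_1) \neq \mathit{des}(i_2)$, $\mathit{des}(i_1) \neq \mathit{src}(i_2)$ and $\mathit{src}(i_1) \neq \mathit{des}(i_2)$. A scheduler $\Sigma : \mathbb{N} \to \{\mathit{execute},\mathit{delay}\}$ is valid for $P$ if for every $n \in \mathbb{N}$, $\Sigma(n) = \mathit{delay}$ implies $\mathit{delayable}(P(n), P(n+1))$. Out-of-order hardware $\mathcal{H}_P$ (with scheduler $\Sigma$). States are $(s, b)$ with $s$ a vanilla hardware state and $b$ either $\bot$ (empty buffer) or one instruction. Transitions: - Execute: if $\Sigma(s.\mathit{pc}) = \mathit{execute}$ and $(s, P(s.\mathit{pc})) \Rightarrow_{\mathcal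 H}^{o} s'$, then $(s,\bot) \xrightarrow{o} (s',\bot)$. - Execute Heap: if $(s,i) \Rightarrow_{\mathcal H}^{o} s'$, then $(s,i) \xrightarrow{o} (s'[\mathit{pc} \mapsto s.\mathit{pc}], \bot)$. - Delay: if $P(s.\mathit{pc}) = i_1$, $\Sigma(s.\mathit{pc}) = \mathit{delay}$, $P(s.\mathit{pc}+1) = i_2$, $\mathit{delayable}(i_1,i_2)$ and $(s[\mathit{pc} \mapsto s.\mathit{pc}+1], i_2) \Rightarrow_{\mathcal H}^{o} s'$, then $(s,\bot) \xrightarrow{o} (s', i_1)$. *)

(* Defs.v *)
From Stdlib Require Import ZArith List.

Record transition_system : Type := TransitionSystem {
  state : Type;
  observation : Type;
  next : state -> state;
  leak : state -> observation
}.

Definition trace (T : transition_system) (q : state T) : nat -> observation T :=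
  fun n => leak T (Nat.iter n (next T) q).

Inductive reg : Type := r1 | r2.

Inductive instr : Type :=
| load (x1 x2 : reg)
| add (x1 x2 : reg) (k : Z)
| beqz (x : reg) (l : nat).

Definition program : Type := nat -> instr.
Definition memory : Type := nat -> Z.
Definition regfile : Type := reg -> Z.

Record arch_state : Type := Arch {
  mem : memory;
  regs : regfile;
  pc : nat
}.

Definition set_pc (s : arch_state) (n : nat) : arch_state :=
  Arch (mem s) (regs s) n.

Definition reg_eq_dec (x y : reg) : {x = y} + {x <> y}.
Proof. decide equality. Defined.

Definition update (a : regfile) (x : reg) (v : Z) : regfile :=
  fun y => if reg_eq_dec y x then v else a y.

Definition address (v : Z) : nat := Z.to_nat (Z.max v 0).

Definition isa_step (s : arch_state) (i : instr) : arch_state :=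
  match i with
  | add x1 x2 k =>
      Arch (mem s) (update (regs s) x1 (regs s x2 + k)%Z) (pc s + 1)
  | load x1 x2 =>
      Arch (mem s) (update (regs s) x1 (mem s (address (regs s x2)))) (pc s + 1)
  | beqz x l =>
      if (regs s x =? 0)%Z then set_pc s l else set_pc s (pc s + 1)
  end.

Definition cache : Type := list nat.

Record hw_state : Type := Hw {
  arch : arch_state;
  cch : cache
}.

Definition hw_set_pc (s : hw_state) (n : nat) : hw_state :=
  Hw (set_pc (arch s) n) (cch s).

(* Successor of the single-instruction hardware semantics; its observation
   label is always the current cache [cch s]. *)
Definition hw_step (s : hw_state) (i : instr) : hw_state :=
  Hw (isa_step (arch s) i)
     (match i with
      | load _ x2 => address (regs (arch s) x2) :: cch s
      | _ => cch s
      end).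

Inductive contract_obs : Type :=
| ObsInt (v : Z)
| ObsBool (b : bool)
| ObsBot.

Definition contract (P : program) : transition_system := {|
  state := arch_state;
  observation := contract_obs;
  next := fun s => isa_step s (P (pc s));
  leak := fun s =>
    match P (pc s) with
    | load _ x2 => ObsInt (regs s x2)
    | beqz x _ => ObsBool (regs s x =? 0)%Z
    | add _ _ _ => ObsBot
    end
|}.

Inductive component : Type :=
| CReg (x : reg)
| CPc.

Definition src (i : instr) : component :=
  match i with
  | add _ x2 _ => CReg x2
  | load _ x2 => CReg x2
  | beqz x _ => CReg x
  end.

Definition des (i : instr) : component :=
  match i with
  | add x1 _ _ => CReg x1
  | load x1 _ => CReg x1
  | beqz _ _ => CPc
  end.

Definition delayable (i1 i2 : instr) : Prop :=
  (forall x l, i1 <> beqz x l) /\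
  des i1 <> des i2 /\ des i1 <> src i2 /\ src i1 <> des i2.

Inductive directive : Type := execute | delay.

Definition scheduler : Type := nat -> directive.

Definition valid (P : program) (Sigma : scheduler) : Prop :=
  forall n, Sigma n = delay -> delayable (P n) (P (n + 1)).

Definition ooo_state : Type := (hw_state * option instr)%type.

Inductive ooo_trans (P : program) (Sigma : scheduler) :
  ooo_state -> cache -> ooo_state -> Prop :=
| Execute s :
    Sigma (pc (arch s)) = execute ->
    ooo_trans P Sigma (s, None) (cch s)
      (hw_step s (P (pc (arch s))), None)
| ExecuteHeap s i :
    ooo_trans P Sigma (s, Some i) (cch s)
      (hw_set_pc (hw_step s i) (pc (arch s)), None)
| Delay s i1 i2 :
    P (pc (arch s)) = i1 ->
    Sigma (pc (arch s)) = delay ->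
    P (pc (arch s) + 1) = i2 ->
    delayable i1 i2 ->
    ooo_trans P Sigma (s, None) (cch s)
      (hw_step (hw_set_pc s (pc (arch s) + 1)) i2, Some i1).

(* The functional form of [ooo_trans]. The side condition [delayable] of
   [Delay] is not tested here because it is implied by [valid P Sigma]; see
   [ooo_transP]. *)
Definition hardware (P : program) (Sigma : scheduler) : transition_system := {|
  state := ooo_state;
  observation := cache;
  next := fun q =>
    let (s, b) := q in
    let n := pc (arch s) in
    match b with
    | Some i => (hw_set_pc (hw_step s i) n, None)
    | None =>
        match Sigma n with
        | execute => (hw_step s (P n), None)
        | delay => (hw_step (hw_set_pc s (n + 1)) (P (n + 1)), Some (P n))
        end
    end;
  leak := fun q => cch (fst q)
|}.

Lemma ooo_transP (P : program) (Sigma : scheduler) (Hvalid : valid P Sigma)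
    (q : ooo_state) (o : cache) (q' : ooo_state) :
  ooo_trans P Sigma q o q' <->
  q' = next (hardware P Sigma) q /\ o = leak (hardware P Sigma) q.
Proof.
split.
- intros H; destruct H as [s Hs | s i | s i1 i2 H1 Hs H2 _]; simpl.
  + rewrite Hs; auto.
  + auto.
  + rewrite Hs, H1, H2; auto.
- intros [-> ->]; destruct q as [s [i|]]; simpl.
  + apply ExecuteHeap.
  + destruct (Sigma (pc (arch s))) eqn:Hs.
    * now apply Execute.
    * apply Delay; auto.
Qed.

(* Main.v *)
Require Import Defs.
From Stdlib Require Import ZArith List FunctionalExtensionality.

(** Draining the buffer of an out-of-order state yields an architectural state
    that the sequential semantics also reaches, since delayable instructions
    commute. Two hardware runs are related by a bisimulation: equal program
    counters, caches and buffers, equal contract traces of the drained states,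
    and equal leakage of the buffered instruction. The contract observation of
    an instruction determines its effect on the program counter and the cache,
    and reordering delayable instructions does not change what they leak. *)

Lemma trace_bisim (T : transition_system) (R : state T -> state T -> Prop)
    (Rnext : forall q1 q2, R q1 q2 -> R (next T q1) (next T q2))
    (Rleak : forall q1 q2, R q1 q2 -> leak T q1 = leak T q2)
    (q1 q2 : state T) :
  R q1 q2 -> trace T q1 = trace T q2.
Proof.
intros H; apply functional_extensionality; intros n; apply Rleak.
induction n as [|n IH]; simpl; auto.
Qed.

Lemma trace_eq_leak (T : transition_system) (q1 q2 : state T) :
  trace T q1 = trace T q2 -> leak T q1 = leak T q2.
Proof. intros H; exact (f_equal (fun t => t 0) H). Qed.

Lemma trace_eq_next (T : transition_system) (q1 q2 : state T) :
  trace T q1 = trace T q2 -> trace T (next T q1) = trace T (next T q2).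
Proof.
intros H; apply functional_extensionality; intros n.
pose proof (f_equal (fun t => t (S n)) H) as Hn; unfold trace in *.
(* [Nat.iter] adds the extra step last; the shifted trace needs it taken first. *)
now rewrite !Nat.iter_succ_r in Hn.
Qed.

(** The instruction is a separate argument because buffered instructions are not the one at the
    program counter. At [P (pc s)] this is the contract's [leak] by conversion. *)
Definition instr_leak (s : arch_state) (i : instr) : contract_obs :=
  match i with
  | load _ x2 => ObsInt (regs s x2)
  | beqz x _ => ObsBool (regs s x =? 0)%Z
  | add _ _ _ => ObsBot
  end.

Lemma hw_step_same_leak (s1 s2 : hw_state) (i : instr) :
  pc (arch s1) = pc (arch s2) -> cch s1 = cch s2 ->
  instr_leak (arch s1) i = instr_leak (arch s2) i ->
  pc (arch (hw_step s1 i)) = pc (arch (hw_step s2 i)) /\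
  cch (hw_step s1 i) = cch (hw_step s2 i).
Proof.
intros Hpc Hc Hl; destruct i as [x1 x2 | x1 x2 k | x l]; simpl in *.
- injection Hl as ->; rewrite Hpc, Hc; auto.
- rewrite Hpc, Hc; auto.
- injection Hl as ->; destruct (_ =? _)%Z; simpl; rewrite ?Hpc, Hc; auto.
Qed.

Lemma regs_isa_step_other (s : arch_state) (i : instr) (x : reg) :
  des i <> CReg x -> regs (isa_step s i) x = regs s x.
Proof.
destruct i as [x1 x2 | x1 x2 k | y l]; simpl; intros H.
- unfold update; destruct (reg_eq_dec x x1); congruence.
- unfold update; destruct (reg_eq_dec x x1); congruence.
- destruct (_ =? _)%Z; reflexivity.
Qed.

Lemma instr_leak_isa_step (s : arch_state) (i j : instr) :
  des i <> src j -> instr_leak (isa_step s i) j = instr_leak s j.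
Proof.
destruct j; simpl; intros H; rewrite ?regs_isa_step_other; auto.
Qed.

Lemma update_comm (a : regfile) (x y : reg) (v w : Z) :
  x <> y -> update (update a x v) y w = update (update a y w) x v.
Proof.
intros H; apply functional_extensionality; intros z; unfold update.
destruct (reg_eq_dec z x), (reg_eq_dec z y); congruence.
Qed.

Lemma update_other (a : regfile) (x y : reg) (v : Z) :
  y <> x -> update a x v y = a y.
Proof. unfold update; destruct (reg_eq_dec y x); congruence. Qed.

(** The program counter is kept, as in [ExecuteHeap]: it already accounts for the buffered
    instruction. *)
Definition drain (q : ooo_state) : arch_state :=
  match q with
  | (s, None) => arch s
  | (s, Some i) => set_pc (isa_step (arch s) i) (pc (arch s))
  end.

(** Neither instruction reads what the other writes, their destinations differ, and memory is never
    written, so the two effects commute. Starting [i2] at [pc + 1] supplies the increment that [i1]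
    would have made. *)
Lemma drain_delayed (s : hw_state) (i1 i2 : instr) :
  delayable i1 i2 ->
  drain (hw_step (hw_set_pc s (pc (arch s) + 1)) i2, Some i1) =
  isa_step (isa_step (arch s) i1) i2.
Proof.
destruct s as [[m a n] c]; intros (Hb & Hdd & Hds & Hsd).
destruct i1 as [x1 x2 | x1 x2 k | x l];
  [ | | now destruct (Hb x l) ];
  destruct i2 as [y1 y2 | y1 y2 k' | y l']; simpl in *;
  unfold set_pc; simpl; rewrite ?update_other by congruence;
  try (destruct (_ =? _)%Z; reflexivity);
  now rewrite update_comm by congruence.
Qed.

(** The last clause records an observation that the trace of the drained state has lost, since the
    buffered instruction is already executed there. *)
Definition same_leakage (P : program) (q1 q2 : ooo_state) : Prop :=
  pc (arch (fst q1)) = pc (arch (fst q2)) /\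
  cch (fst q1) = cch (fst q2) /\
  snd q1 = snd q2 /\
  trace (contract P) (drain q1) = trace (contract P) (drain q2) /\
  (forall i, snd q1 = Some i ->
     instr_leak (arch (fst q1)) i = instr_leak (arch (fst q2)) i).

Lemma same_leakage_execute (P : program) (s1 s2 : hw_state) :
  same_leakage P (s1, None) (s2, None) ->
  same_leakage P (hw_step s1 (P (pc (arch s1))), None)
                 (hw_step s2 (P (pc (arch s2))), None).
Proof.
intros (Hpc & Hc & _ & Ht & _); cbn [fst snd drain] in *.
pose proof (trace_eq_leak _ _ _ Ht) as Hl.
change (instr_leak (arch s1) (P (pc (arch s1))) =
        instr_leak (arch s2) (P (pc (arch s2)))) in Hl.
apply trace_eq_next in Ht.
rewrite <- Hpc in Hl |- *.
destruct (hw_step_same_leak s1 s2 _ Hpc Hc Hl) as [Hpc' Hc'].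
repeat split; try assumption; [ | discriminate].
simpl in Ht; rewrite <- Hpc in Ht; exact Ht.
Qed.

Lemma same_leakage_execute_heap (P : program) (s1 s2 : hw_state) (i : instr) :
  same_leakage P (s1, Some i) (s2, Some i) ->
  same_leakage P (hw_set_pc (hw_step s1 i) (pc (arch s1)), None)
                 (hw_set_pc (hw_step s2 i) (pc (arch s2)), None).
Proof.
intros (Hpc & Hc & _ & Ht & Hl).
specialize (Hl i eq_refl).
destruct (hw_step_same_leak s1 s2 i Hpc Hc Hl) as [_ Hc'].
(* Emptying the buffer leaves the drained state unchanged up to conversion, so the trace equality
   carries over. *)
repeat split; try assumption; discriminate.
Qed.

Lemma pc_isa_step_not_branch (s : arch_state) (i : instr) :
  (forall x l, i <> beqz x l) -> pc (isa_step s i) = pc s + 1.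
Proof. destruct i as [| |x l]; intros H; [ | | destruct (H x l)]; auto. Qed.

(** One delay step matches two contract steps: the first observation covers the buffered
    instruction, the second the one executed early. *)
Lemma same_leakage_delay (P : program) (s1 s2 : hw_state) :
  delayable (P (pc (arch s1))) (P (pc (arch s1) + 1)) ->
  same_leakage P (s1, None) (s2, None) ->
  same_leakage P
    (hw_step (hw_set_pc s1 (pc (arch s1) + 1)) (P (pc (arch s1) + 1)),
     Some (P (pc (arch s1))))
    (hw_step (hw_set_pc s2 (pc (arch s2) + 1)) (P (pc (arch s2) + 1)),
     Some (P (pc (arch s2)))).
Proof.
intros Hd (Hpc & Hc & _ & Ht & _); cbn [fst snd drain] in *.
pose proof (trace_eq_leak _ _ _ Ht) as Hl1.
change (instr_leak (arch s1) (P (pc (arch s1))) =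
        instr_leak (arch s2) (P (pc (arch s2)))) in Hl1.
apply trace_eq_next in Ht; cbn [next contract] in Ht.
pose proof (trace_eq_leak _ _ _ Ht) as Hl2.
change (instr_leak (isa_step (arch s1) (P (pc (arch s1))))
          (P (pc (isa_step (arch s1) (P (pc (arch s1)))))) =
        instr_leak (isa_step (arch s2) (P (pc (arch s2))))
          (P (pc (isa_step (arch s2) (P (pc (arch s2))))))) in Hl2.
apply trace_eq_next in Ht; cbn [next contract] in Ht.
pose proof Hd as (Hb & _ & Hds & Hsd).
rewrite <- Hpc in Hl1, Hl2, Ht.
rewrite !pc_isa_step_not_branch, <- Hpc in Hl2, Ht by assumption.
(* The delayed instruction does not write the source of its successor, which thus leaks the same
   when executed first. *)
rewrite !instr_leak_isa_step in Hl2 by assumption.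
rewrite <- !drain_delayed, <- Hpc in Ht by assumption.
rewrite <- Hpc.
destruct (hw_step_same_leak (hw_set_pc s1 (pc (arch s1) + 1))
            (hw_set_pc s2 (pc (arch s1) + 1)) _ eq_refl Hc Hl2) as [Hpc' Hc'].
repeat split; try assumption.
intros i [= <-]; cbn [fst arch hw_step].
(* Conversely, the early instruction does not write the source of the delayed one, so [Hl1] still
   applies. *)
rewrite !instr_leak_isa_step by (intros E; apply Hsd; auto).
exact Hl1.
Qed.

Lemma same_leakage_next (P : program) (Sigma : scheduler)
    (Hvalid : valid P Sigma) (q1 q2 : ooo_state) :
  same_leakage P q1 q2 ->
  same_leakage P (next (hardware P Sigma) q1) (next (hardware P Sigma) q2).
Proof.
destruct q1 as [s1 b1], q2 as [s2 b2]; intros H.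
pose proof H as (Hpc & _ & Hb & _); cbn [fst snd] in Hpc, Hb; subst b2.
cbn [next hardware]; destruct b1 as [i|].
- now apply same_leakage_execute_heap.
- replace (Sigma (pc (arch s2))) with (Sigma (pc (arch s1))) by now rewrite Hpc.
  destruct (Sigma (pc (arch s1))) eqn:HS.
  + now apply same_leakage_execute.
  + now apply same_leakage_delay; [apply Hvalid | ].
Qed.

Theorem mainTheorem8 (P : program) (Sigma : scheduler) (Hvalid : valid P Sigma)
    (m1 m2 : memory) (a1 a2 : regfile) (c : cache) (n : nat) :
  trace (contract P) (Arch m1 a1 n) = trace (contract P) (Arch m2 a2 n) ->
  trace (hardware P Sigma) (Hw (Arch m1 a1 n) c, None) =
  trace (hardware P Sigma) (Hw (Arch m2 a2 n) c, None).
Proof.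
intros H; apply (trace_bisim (hardware P Sigma) (same_leakage P)).
- exact (same_leakage_next P Sigma Hvalid).
- now intros q1 q2 (_ & Hc & _).
- repeat split; [exact H | discriminate].
Qed.
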